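(* Write a creation sequence $(b_1,\ldots,b_8)$ as the binary string $b_1b_2\cdots b_8$, with $b_1=0$ and $b_8=1$. For the connected threshold graphs $G$ of order $8$ the values of $q(G)$ are as follows. (i) $q(G)=4$ for the creation sequences $00010001$ and $00001001$. (ii) $q(G)\in\{3,4\}$ for the creation sequences $01001001$ and $00011001$. (iii) $q(G)=2$ for each of the creation sequences $00101011$, $00100111$, $00011011$, $00010111$, $00001111$, $01101011$, $01100111$, $01011011$, $01010111$, $01001111$, $00111011$, $00110111$, $00101111$, $00011111$, $01111011$, $01110111$, $01101111$, $01011111$, $00111111$, $01111111$. (iv) $q(G)=3$ for every one of the remaining $40$ creation sequences of length $8$ with $b_1=0$ and $b_8=1$.
   Context: For a simple graph $G$ on $n$ vertices, $S(G)$ is the set of all real symmetric $n\times n$ matrices $A=(a_{ij})$ such that for $i\neq j$, $a_{ij}\neq 0$ if and only if $ij\in E(G)$ (diagonal entries are unrestricted). $q(A)$ is the number of distinct eigenvalues of $A$ and $q(G)=\min\{q(A): A\in S(G)\}$. The threshold graph with creation sequence $(b_1,\ldots,b_n)$, where $b_i\in\{0,1\}$ and $b_1=0$, has vertices $v_1,\ldots,v_n$ and, for $i<j$, $v_i$ and $v_j$ are adjacent if and only if $b_j=1$; connected threshold graphs are those with $b_n=1$. *)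

(* Defs.v *)
From Stdlib Require Import Ascii String.
From mathcomp Require Import all_boot all_order all_algebra.
From mathcomp Require Import finmap.
From mathcomp Require Import boolp classical_sets cardinality reals.

Set Implicit Arguments.
Unset Strict Implicit.
Unset Printing Implicit Defensive.

Import GRing.Theory Num.Theory.
Local Open Scope ring_scope.
Local Open Scope classical_set_scope.

Record sgraph (n : nat) := SGraph {
  edge :> rel 'I_n;
  edge_sym : symmetric edge;
  edge_irr : irreflexive edge }.

Definition symm_mx (R : realType) n (G : sgraph n) : set 'M[R]_n :=
  [set A | A^T = A /\ forall i j, i != j -> (A i j != 0) = G i j].

Lemma finite_eigenvalue (F : fieldType) n (A : 'M[F]_n) :
  finite_set [set a | eigenvalue A a].
Proof.
pose p := char_poly A.
have p0 : p != 0 by rewrite monic_neq0 // char_poly_monic.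
have bound (k : nat) (s : seq F) : uniq s -> size s = k ->
    all (eigenvalue A) s -> (k < size p)%N.
  move=> us <- es; apply: max_poly_roots => //.
  by apply: sub_all es => a; rewrite eigenvalue_root_char.
pose P k := `[< exists s : seq F, [/\ uniq s, size s = k & all (eigenvalue A) s] >].
have exP : exists k, P k by exists 0; apply/asboolP; exists [::].
have leP k : P k -> (k <= size p)%N.
  by move=> /asboolP[s [us sk es]]; apply/ltnW/(bound k s).
have [k /asboolP[s [us sk es]] kmax] := ex_maxnP exP leP.
apply: (@sub_finite_set _ _ [set` s]); last exact: finite_seq.
move=> a /= ea; apply: contraT => as_.
have : (k.+1 <= k)%N; last by rewrite ltnn.
by apply: kmax; apply/asboolP; exists (a :: s); rewrite /= as_ us sk ea es.
Qed.

(* [eigenvalue] ranges over R, which loses nothing on S(G) since real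
   symmetric matrices have only real eigenvalues; the set is finite by
   [finite_eigenvalue], so [fset_set] does not return its default value. *)
Definition q_mx (R : realType) n (A : 'M[R]_n) : nat :=
  #|` fset_set [set a | eigenvalue A a]|.

Lemma q_mx_size (R : realType) n (A : 'M[R]_n) (s : seq R) :
  uniq s -> s =i eigenvalue A -> q_mx A = size s.
Proof.
move=> us se; rewrite /q_mx.
have -> : [set a | eigenvalue A a] = [set` s].
  by apply/seteqP; split=> a /=; rewrite se.
have -> : fset_set [set` s] = seq_fset tt s.
  apply/fsetP => a; rewrite in_fset_set; last exact: finite_seq.
  by rewrite seq_fsetE; apply/idP/idP; rewrite inE.
by rewrite size_seq_fset undup_id.
Qed.

Definition q_attained (R : realType) n (G : sgraph n) : pred nat :=
  fun k => `[< exists2 A : 'M[R]_n, symm_mx G A & q_mx A = k >].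

Lemma q_attained_ex (R : realType) n (G : sgraph n) :
  exists k, q_attained R G k.
Proof.
pose A : 'M[R]_n := \matrix_(i, j) (G i j)%:R.
exists (q_mx A); apply/asboolP; exists A => //; split.
  by apply/matrixP => i j; rewrite !mxE edge_sym.
by move=> i j _; rewrite mxE pnatr_eq0 eqb0 negbK.
Qed.

Definition q_graph (R : realType) n (G : sgraph n) : nat :=
  ex_minn (q_attained_ex R G).

Section Threshold.
Variables (n : nat) (b : n.-tuple bool).

(* Vertices are numbered from 0, so the entry b_{i+1} of the creation sequence
   (b_1, ..., b_n) is [tnth b i]. *)
Definition threshold_edge : rel 'I_n := fun i j =>
  ((i < j)%N && tnth b j) || ((j < i)%N && tnth b i).

Lemma threshold_sym : symmetric threshold_edge.
Proof. by move=> i j; rewrite /threshold_edge orbC. Qed.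

Lemma threshold_irr : irreflexive threshold_edge.
Proof. by move=> i; rewrite /threshold_edge ltnn. Qed.

Definition threshold : sgraph n := SGraph threshold_sym threshold_irr.

End Threshold.

Fixpoint bits (s : string) : bitseq :=
  if s is String c s' then Ascii.eqb c "1"%char :: bits s' else [::].

(* Strings of length other than 8 would be silently dropped; the lists below
   contain none. *)
Definition creation8 (ss : seq string) : {set 8.-tuple bool} :=
  [set b : 8.-tuple bool | tval b \in [seq bits s | s <- ss]]%SET.

Definition connected_seqs8 : {set 8.-tuple bool} :=
  [set b : 8.-tuple bool | (tnth b ord0 == false) && (tnth b ord_max == true)]%SET.

Definition seqs_i := creation8 [:: "00010001"; "00001001"]%string.

Definition seqs_ii := creation8 [:: "01001001"; "00011001"]%string.

Definition seqs_iii := creation8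
  [:: "00101011"; "00100111"; "00011011"; "00010111"; "00001111";
      "01101011"; "01100111"; "01011011"; "01010111"; "01001111";
      "00111011"; "00110111"; "00101111"; "00011111"; "01111011";
      "01110111"; "01101111"; "01011111"; "00111111"; "01111111"]%string.

Definition seqs_iv : {set 8.-tuple bool} :=
  (connected_seqs8 :\: (seqs_i :|: seqs_ii :|: seqs_iii))%SET.

(* Main.v *)
Require Import Defs.
From Stdlib Require Import ZArith String.
From mathcomp Require Import all_boot all_order all_algebra.
From mathcomp Require Import boolp reals complex.
From mathcomp Require Import zify ring lra ssrZ.

(** A real symmetric [A] with [q(A) <= k] satisfies a polynomial relation of
    degree [k], by the spectral theorem.

    [q = 2]: then [A^2] is a combination of [A] and [1], so the rows of pairwise
    nonadjacent vertices are orthogonal. If their common neighbours all lie in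
    a set [T], and each of them has a neighbour in [T], then there are at most
    [#|T|] such vertices. Among the 64 graphs, exactly the 20 of (iii) are not
    excluded by this.

    [q = 3] is excluded for (i) by comparing entries of a cubic relation
    [A^3 = al A^2 + be A + ga]. The graph is a star [K_{1,m}], [m >= 3], with at
    least two isolated vertices added, and then joined to a vertex [u]. Up to
    shifting [A] the isolated vertices have diagonal entry 0; then the block [S]
    of the star kills the vector of edge weights to [u], its leaves share a
    diagonal entry [e], and [Y + e^2 + s^2 = 0], where [Y] and [s^2] are the sums of the
    squared weights of the edges of the star, respectively of the edges at [u].

    The upper bounds come from explicit matrices [D C D], with [C] an integer
    matrix and [D] the square root of a positive integer diagonal matrix [W];
    these have the eigenvalues of [C W]. All the eigenvalues used are integers. *)

Set Implicit Arguments.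
Unset Strict Implicit.
Unset Printing Implicit Defensive.

Import Order.TTheory GRing.Theory Num.Theory.
Local Open Scope ring_scope.

(** * Annihilating polynomials of symmetric matrices *)

(** The value at [A] of the monic polynomial with root list [s]; in this form it can be evaluated on
    lists of integers. *)
Definition char_prod (R : comNzRingType) n (A : 'M[R]_n) (s : seq R) : 'M[R]_n :=
  \big[mulmx/1%:M]_(a <- s) (A - a%:M).

(** Each factor moves past [D], since scalar matrices are central. For invertible [D] this transfers
    vanishing of the product between similar matrices, both for the diagonalisation and for the
    integer certificates. *)
Lemma char_prod_intertwine (R : comNzRingType) n (A B D : 'M[R]_n) (s : seq R) :
  A *m D = D *m B -> char_prod A s *m D = D *m char_prod B s.
Proof.
move=> AD; rewrite /char_prod.
elim: s => [|a s IHs]; first by rewrite !big_nil mul1mx mulmx1.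
rewrite !big_cons -mulmxA IHs !mulmxA mulmxBl mulmxBr AD.
by rewrite mul_scalar_mx mul_mx_scalar.
Qed.

(** An eigenvector for [a] is multiplied by $\prod_b (a-b)$, so one of these factors vanishes. *)
Lemma char_prod_eigenvalue (F : fieldType) n (A : 'M[F]_n) s a :
  char_prod A s = 0 -> eigenvalue A a -> a \in s.
Proof.
move=> A0 /eigenvalueP[v vA v0].
have key t : v *m char_prod A t = (\prod_(b <- t) (a - b)) *: v.
  rewrite /char_prod; elim: t => [|b t IHt].
    by rewrite !big_nil mulmx1 scale1r.
  rewrite !big_cons mulmxA mulmxBr vA mul_mx_scalar -scalerBl -scalemxAl IHt.
  by rewrite scalerA.
move/eqP: (key s); rewrite A0 mulmx0 eq_sym scaler_eq0 (negPf v0) orbF.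
rewrite prodf_seq_eq0 => /hasP[b bs /=].
by rewrite subr_eq0 => /eqP ->.
Qed.

Lemma q_mx_le (R : realType) n (A : 'M[R]_n) s :
  char_prod A s = 0 -> (q_mx A <= size s)%N.
Proof.
move=> A0; rewrite (@q_mx_size _ _ _ [seq a <- undup s | eigenvalue A a]).
- by rewrite size_filter (leq_trans (count_size _ _)) ?size_undup.
- exact/filter_uniq/undup_uniq.
move=> a; rewrite mem_filter mem_undup.
by apply/andP/idP => [[] //|ea]; split=> //; apply: char_prod_eigenvalue A0 ea.
Qed.

Lemma char_prod_map (R S : comNzRingType) (f : {rmorphism R -> S}) n
    (A : 'M[R]_n) s :
  map_mx f (char_prod A s) = char_prod (map_mx f A) (map f s).
Proof.
rewrite /char_prod; elim: s => [|a s IHs]; first by rewrite !big_nil map_mx1.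
by rewrite !big_cons map_mxM IHs raddfB /= map_scalar_mx.
Qed.

Lemma char_prod_diag (F : fieldType) n (d : 'rV[F]_n) s :
  char_prod (diag_mx d) s = diag_mx (\row_j \prod_(a <- s) (d 0 j - a)).
Proof.
rewrite /char_prod; elim: s => [|a s IHs].
  by rewrite big_nil -diag_const_mx; congr diag_mx; apply/rowP=> j; rewrite !mxE big_nil.
rewrite big_cons IHs -diag_const_mx -raddfB mulmx_diag; congr diag_mx.
by apply/rowP=> j; rewrite !mxE big_cons.
Qed.

(** Over the closed field [C] the matrix becomes hermitian, and the spectral theorem gives it a real
    diagonal form, whose entries come from [R] by [fP]. Listed without repetition they are the
    roots. *)
Lemma symmetric_char_prod_complex (R : realType) (C : numClosedFieldType)
    (f : {rmorphism R -> C}) (fP : forall x, (exists y, x = f y) <-> x \is Num.real)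
    n (A : 'M[R]_n) : A^T = A ->
  exists2 s, size s = q_mx A & char_prod A s = 0.
Proof.
move=> As.
pose Ac := map_mx f A.
have Ah : Ac \is hermsymmx.
  apply: realsym_hermsym.
    by apply/is_hermitianmxP; rewrite expr0 scale1r map_mx_id // /Ac map_trmx As.
  by apply/mxOverP => i j; rewrite mxE; apply/fP; exists (A i j).
have /orthomx_spectralP := hermitian_normalmx Ah.
have := hermitian_spectral_diag_real Ah; have := spectral_unit Ac.
set P := spectralmx Ac; set d := spectral_diag Ac => Pu /mxOverP dR AE.
have PA : P *m Ac = diag_mx d *m P by rewrite AE !mulmxA mulmxV // mul1mx.
have [g gE] : exists g : 'I_n -> R, forall j, f (g j) = d 0 j.
  have /choice[g gE] : forall j, exists y, d 0 j = f y.
    by move=> j; apply/fP; exact: dR.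
  by exists g => j.
pose s := undup [seq g j | j <- enum 'I_n].
have s0 : char_prod A s = 0.
  suff: map_mx f (char_prod A s) = 0 by move/eqP; rewrite map_mx_eq0 => /eqP.
  rewrite char_prod_map -/Ac.
  have := char_prod_intertwine (map f s) (esym PA).
  rewrite char_prod_diag; set D := diag_mx _.
  have -> : D = 0.
    rewrite /D (_ : \row_j _ = 0) ?raddf0 //; apply/rowP=> j; rewrite !mxE.
    apply/eqP; rewrite prodf_seq_eq0; apply/hasP; exists (f (g j)).
      by apply: map_f; rewrite mem_undup map_f ?mem_enum.
    by rewrite /= gE subrr.
  by rewrite mul0mx => /esym/(congr1 (mulmx (invmx P))); rewrite mulKmx // mulmx0.
(* Each diagonal entry is in turn an eigenvalue, with row [j] of [P] as eigenvector, so [s] lists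
   exactly the eigenvalues. *)
exists s => //; apply/esym/q_mx_size; first exact: undup_uniq.
move=> a; apply/idP/idP => [|/(char_prod_eigenvalue s0)//].
rewrite mem_undup => /mapP[j _ ->]; rewrite /in_mem /=.
rewrite eigenvalue_root_char -(fmorph_root f) map_char_poly gE -/Ac.
rewrite -eigenvalue_root_char; apply/eigenvalueP; exists (row j P).
  by rewrite -row_mul PA row_mul row_diag_mx -scalemxAl -rowE.
apply/eqP => /(congr1 (mulmx^~ (invmx P))); rewrite -row_mul mulmxV // mul0mx.
by move/rowP/(_ j)/eqP; rewrite !mxE eqxx oner_eq0.
Qed.

Lemma symmetric_char_prod (R : realType) n (A : 'M[R]_n) : A^T = A ->
  exists2 s, size s = q_mx A & char_prod A s = 0.
Proof.
apply: (@symmetric_char_prod_complex R R[i] (real_complex R)) => x.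
by split => [[y ->]|/complex_realP//]; apply/complex_realP; exists y.
Qed.

(** * Lower bounds *)

(** A shorter list is padded with zeros, so that the lower bounds only expand products of exactly
    [k] factors. *)
Lemma q_mx_char_prod (R : realType) n (A : 'M[R]_n) k : A^T = A ->
  (q_mx A <= k)%N -> exists2 s, size s = k & char_prod A s = 0.
Proof.
move=> /symmetric_char_prod[s <- s0]; elim: k => [|k IHk].
  by rewrite leqn0 => /eqP sz; exists s.
rewrite leq_eqVlt => /predU1P[sz|/IHk[t tk t0]]; first by exists s.
by exists (0 :: t); rewrite /= ?tk // /char_prod big_cons [X in _ *m X]t0 mulmx0.
Qed.

(** A single root would make [A] scalar, against its nonzero entry at the edge. *)
Lemma q_mx_gt1 (R : realType) n (G : sgraph n) (A : 'M[R]_n) i j :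
  symm_mx G A -> G i j -> (1 < q_mx A)%N.
Proof.
move=> [As AG] Gij; rewrite ltnNge; apply/negP => /(q_mx_char_prod As).
have ij : i != j by apply: contraTN Gij => /eqP->; rewrite edge_irr.
case=> [[|a []]// _]; rewrite /char_prod big_cons big_nil mulmx1.
move=> /eqP; rewrite subr_eq0 => /eqP AE.
by have := AG i j ij; rewrite Gij AE mxE (negPf ij) eqxx.
Qed.

(* The rows of [A] indexed by [s] are pairwise orthogonal when [A ^+ 2] is a
   combination of [A] and [1], and only their entries in the columns of [t]
   contribute to the inner products. *)
Lemma q_mx_gt2 (R : realType) n (G : sgraph n) (A : 'M[R]_n) (s t : seq 'I_n) :
  symm_mx G A -> uniq s -> uniq t -> (size t < size s)%N ->
  {in s, forall i, exists2 k, k \in t & G i k} ->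
  {in s &, forall i j, i != j ->
    ~~ G i j /\ forall k, G i k -> G j k -> k \in t} ->
  (2 < q_mx A)%N.
Proof.
move=> [As AG] us ut st sN sI; rewrite ltnNge; apply/negP => /(q_mx_char_prod As).
case=> [[|a [|b []]]// _]; rewrite /char_prod !big_cons big_nil mulmx1.
rewrite mulmxBl !mulmxBr mul_scalar_mx mul_mx_scalar mul_scalar_mx => AA.
have AC i j : A j i = A i j by rewrite -{1}As mxE.
have A2 i j : i != j -> ~~ G i j -> \sum_k A i k * A j k = 0.
  move=> ij nG; have Aij : A i j = 0 by apply/eqP; move: nG; rewrite -AG // negbK.
  move/matrixP/(_ i j): AA; rewrite !mxE Aij (negPf ij) !mulr0n !mulr0 !subr0 => AA0.
  by rewrite -[RHS]AA0; apply: eq_bigr => k _; rewrite [A j k]AC.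
pose f := tnth (in_tuple s); pose g := tnth (in_tuple t).
(* The product [N *m N^T] will be diagonal with nonzero entries, so [N] has rank [size s], more than
   its number of columns. *)
pose N : 'M_(size s, size t) := \matrix_(x, y) A (f x) (g y).
have fs x : f x \in s by apply: mem_tnth.
have fI : injective f by apply/tuple_uniqP.
have NNE x y : (N *m N^T) x y = \sum_(k in t) A (f x) k * A (f y) k.
  rewrite -big_uniq // big_tnth mxE.
  by apply: eq_bigr => z _; rewrite !mxE.
have NNd : N *m N^T = diag_mx (\row_x \sum_(k in t) A (f x) k ^+ 2).
  apply/matrixP => x y; rewrite NNE !mxE; have [<-|xy] := eqVneq.
    rewrite mulr1n; by apply: eq_bigr => k _; rewrite expr2.
  have fxy : f x != f y by rewrite (inj_eq fI).
  have [nG tG] := sI _ _ (fs x) (fs y) fxy.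
  (* Terms outside [t] vanish: in columns [f x] and [f y] because these vertices are nonadjacent,
     elsewhere because the column is not a common neighbour. *)
  rewrite mulr0n -[RHS](A2 _ _ fxy nG) [RHS](bigID (mem t)) /= [X in _ = _ + X]big1 ?addr0 //.
  have Axy : A (f x) (f y) = 0 by apply/eqP; move: nG; rewrite -AG // negbK.
  move=> k kt; have [->|kx] := eqVneq k (f x); first by rewrite AC Axy mulr0.
  have [->|ky] := eqVneq k (f y); first by rewrite Axy mul0r.
  apply/eqP; rewrite mulf_eq0; apply: contraNT kt; rewrite negb_or.
  by rewrite !AG 1?eq_sym // => /andP[]; apply: tG.
suff: (size s <= \rank N)%N by rewrite leqNgt (leq_ltn_trans (rank_leq_col N)).
apply: leq_trans (mxrankM_maxl N N^T).
rewrite mxrank_unit // unitmxE NNd det_diag unitfE; apply/prodf_neq0 => x _.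
rewrite mxE; have [k kt Gk] := sN _ (fs x).
have xk : f x != k by apply: contraTN Gk => /eqP->; rewrite edge_irr.
rewrite (bigD1 k) //= gt_eqF // ltr_wpDr ?sumr_ge0 // => [l _|].
  exact: sqr_ge0.
by rewrite exprn_even_gt0 //= AG.
Qed.

Lemma symm_mx_sum (R : realType) n (G : sgraph n) (A : 'M[R]_n) i (F : 'I_n -> R) :
  symm_mx G A ->
  \sum_k A i k * F k = A i i * F i + \sum_(k | G i k) A i k * F k.
Proof.
move=> [_ AG]; rewrite (bigD1 i) //=; congr (_ + _); rewrite [LHS](bigID (G i)) /=.
rewrite [X in _ + X]big1 ?addr0 => [|k /andP[ki]]; last first.
  by rewrite eq_sym in ki; rewrite -AG // negbK => /eqP->; rewrite mul0r.
apply: eq_bigl => k; rewrite andb_idl // => ik.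
by apply: contraTN ik => /eqP->; rewrite edge_irr.
Qed.

(** * Dominated stars: excluding three eigenvalues *)

Section DominatedStar.
Variables (n : nat) (G : sgraph n) (u c t1 t2 i1 i2 i3 : 'I_n) (L : pred 'I_n).

(** The star has centre [c] and leaf set [L]; [u] is the dominating vertex, and [t1], [t2] are two
    of the added isolated vertices, pendant at [u]. Three leaves are named, but [L] may hold
    more. *)
Record dominated_star := DominatedStar {
  center_edge : forall k, G c k = (k == u) || L k;
  leaf_edge : forall i k, L i -> G i k = (k == u) || (k == c);
  pendant_edge : forall t k, t \in [:: t1; t2] -> G t k = (k == u);
  pendant_neq : t1 != t2;
  leaf_neq : uniq [:: i1; i2; i3];
  leafP : all L [:: i1; i2; i3] }.

End DominatedStar.

Lemma mulf_cancel (F : fieldType) (x a b : F) : x != 0 -> x * (a - b) = 0 -> a = b.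
Proof. by move=> /mulfI xI; rewrite -[RHS](mulr0 x) => /xI/eqP; rewrite subr_eq0 => /eqP. Qed.

(** No shift of [A] is made: the common diagonal entry [d] of the pendant vertices takes the place
    of 0, and the contradiction is [Y + (d - e) ^+ 2 + S = 0] with [S] positive. *)
Lemma q_mx_gt3 (R : realType) n (G : sgraph n) u c t1 t2 i1 i2 i3 L (A : 'M[R]_n) :
  dominated_star G u c t1 t2 i1 i2 i3 L -> symm_mx G A -> (3 < q_mx A)%N.
Proof.
case=> cE iE tE t12 /= /and3P[]; rewrite !inE negb_or => /andP[i12 i13] i23 _.
case/and4P => L1 L2 L3 _ AS; have [As AG] := AS.
rewrite ltnNge; apply/negP => /(q_mx_char_prod As).
case=> [[|r1 [|r2 [|r3 []]]]// _]; rewrite /char_prod !big_cons big_nil mulmx1 => A3.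
have AC i j : A j i = A i j by rewrite -{1}As mxE.
pose Q := A *m A.
have QC i j : Q j i = Q i j.
  by rewrite !mxE; apply: eq_bigr => k _; rewrite mulrC (AC j) (AC i).
(* Coefficients of the cubic with roots [r1], [r2], [r3]; its constant term only affects diagonal
   entries. *)
pose al := r1 + r2 + r3; pose be := - (r1 * r2 + r1 * r3 + r2 * r3).
have {}A3 i j : i != j -> \sum_k A i k * Q k j = al * Q i j + be * A i j.
  move=> ij; have /matrixP/(_ i j) : A *m Q = al *: Q + be *: A + (r1 * r2 * r3)%:M.
    have mulB a (X : 'M_n) : (A - a%:M) *m X = A *m X - a *: X.
      by rewrite mulmxBl mul_scalar_mx.
    move: A3; rewrite !mulB !(mulmxBr, mul_mx_scalar, =^~ scalemxAr) -/Q => A3.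
    rewrite -[LHS]subr0 -A3; move: (A *m Q) (Q) => AQ Q'.
    apply/matrixP => x y; rewrite !mxE /al /be.
    by case: eqP => _; rewrite ?mulr1n ?mulr0n; ring.
  by rewrite mxE => ->; rewrite !mxE (negPf ij) addr0.
clearbody al be.
have uc : u != c by apply/eqP => ucE; have := edge_irr G c; rewrite cE ucE eqxx.
have uL i : L i -> i != u.
  by move=> Li; apply/eqP => iu; have := edge_irr G i; rewrite iE // -iu eqxx.
have cL i : L i -> i != c.
  by move=> Li; apply/eqP => ic; have := edge_irr G i; rewrite iE // -ic eqxx orbT.
have sumt t F : t \in [:: t1; t2] -> \sum_k A t k * F k = A t t * F t + A t u * F u.
  move=> tT; rewrite (symm_mx_sum _ _ AS); congr (_ + _).
  by rewrite (big_pred1 u) // => k; rewrite tE.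
have sumi i F : L i ->
    \sum_k A i k * F k = A i i * F i + A i c * F c + A i u * F u.
  move=> Li; rewrite (symm_mx_sum _ _ AS) (bigD1 u) /=; last by rewrite iE ?eqxx.
  rewrite (big_pred1 c) => [|k]; first by rewrite -addrA [X in _ + X]addrC.
  by rewrite iE //=; case: (eqVneq k u) => [->|_]; rewrite ?(negPf uc) ?andbF ?andbT.
have sumc F : \sum_k A c k * F k = A c c * F c + A c u * F u + \sum_(k | L k) A c k * F k.
  rewrite (symm_mx_sum _ _ AS) (bigD1 u) /=; last by rewrite cE ?eqxx.
  rewrite addrA; congr (_ + _); apply: eq_bigl => k; rewrite cE.
  case: (eqVneq k u) => [->|_]; rewrite ?andbT ?andbF //=.
  by apply/esym/negP => /uL; rewrite eqxx.
have tu t : t \in [:: t1; t2] -> t != u.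
  by move=> tT; apply/eqP => tuE; have := edge_irr G t; rewrite tE // -tuE eqxx.
have tc t : t \in [:: t1; t2] -> t != c.
  move=> tT; apply/eqP => tcE; have := tE t i1 tT.
  by rewrite tcE cE L1 orbT (negPf (uL _ L1)).
have tL t i : t \in [:: t1; t2] -> L i -> t != i.
  move=> tT Li; apply/eqP => tiE; have := tE t c tT.
  by rewrite tiE iE // eqxx orbT eq_sym (negPf uc).
have A0 i j : i != j -> ~~ G i j -> A i j = 0.
  by move=> ij; rewrite -AG // negbK => /eqP.
have Atu t : t \in [:: t1; t2] -> A t u != 0.
  by move=> tT; rewrite AG ?tu // tE.
have Atj t j : t \in [:: t1; t2] -> t != j -> j != u -> A t j = 0.
  by move=> tT tj ju; apply: A0; rewrite // tE.
have Aij i j : L i -> L j -> i != j -> A i j = 0.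
  by move=> Li Lj ij; apply: A0; rewrite // iE // negb_or uL ?cL.
have Aiu i : L i -> A i u != 0 by move=> Li; rewrite AG ?uL // iE ?eqxx.
have Aic i : L i -> A i c != 0 by move=> Li; rewrite AG ?cL // iE ?eqxx ?orbT.
have Acu : A c u != 0 by rewrite AG 1?eq_sym // cE eqxx.
have Qt t j : t \in [:: t1; t2] -> Q t j = A t t * A t j + A t u * A j u.
  by move=> tT; rewrite mxE sumt // (AC j u).
have Qi i j : L i -> Q i j = A i i * A i j + A i c * A c j + A i u * A j u.
  by move=> Li; rewrite mxE sumi // (AC j u).
pose d := A t1 t1; pose du := A u u; pose dc := A c c.
have T1 : t1 \in [:: t1; t2] by rewrite inE eqxx.
have T2 : t2 \in [:: t1; t2] by rewrite !inE eqxx orbT.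
(* Entry [(t1, t2)] of the cubic relation, divided by the two edge weights. *)
have E1 : al = d + A t2 t2 + du.
  have := A3 t1 t2 t12; rewrite sumt // (QC t2 u) !Qt // (Atj t1 t2) ?tu // => E.
  by apply: (mulf_cancel (mulf_neq0 (Atu _ T1) (Atu _ T2))); rewrite /d /du; lra.
have E2 t i : t \in [:: t1; t2] -> L i ->
    A i i * A i u + A i c * A c u = (al - A t t - du) * A i u.
  move=> tT Li; have it : i != t by rewrite eq_sym tL.
  have := A3 i t it; rewrite sumi // (QC t i) (QC t c) (QC t u) !Qt //.
  have cu : c != u by rewrite eq_sym.
  have Ati : A t i = 0 by apply: Atj => //; [exact: tL | exact: uL].
  have Atc : A t c = 0 by apply: Atj => //; exact: tc.
  rewrite (AC t i) Ati Atc => E.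
  by apply: (mulf_cancel (Atu _ tT)); rewrite /du; lra.
(* The left side of [E2] does not depend on [t], so the two pendant diagonal entries agree. *)
have {}E1 : al = 2 * d + du.
  have := E2 _ _ T1 L1; rewrite (E2 _ _ T2 L1) => /(mulIf (Aiu _ L1)).
  by rewrite -/d => E; lra.
(* The leaf rows of the statement that the star block sends the vector of edge weights to [u] to [d]
   times itself; [ZE] is the row of [c]. *)
have {}E2 i : L i -> A i c * A c u = (d - A i i) * A i u.
  by move=> Li; have := E2 _ _ T1 Li; rewrite E1 -/d; lra.
have E4 i j : L i -> L j -> i != j -> A i i + A j j + dc = al.
  move=> Li Lj ij; have := A3 i j ij.
  rewrite sumi // (QC j c) (QC j u) !Qi // (AC j c) (Aij i j) // => E.
  have Ei : A j u * (A i c * A c u) = A j u * ((d - A i i) * A i u) by rewrite E2.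
  have Ej : A i u * (A j c * A c u) = A i u * ((d - A j j) * A j u) by rewrite E2.
  apply: (mulf_cancel (mulf_neq0 (Aic _ Li) (Aic _ Lj))).
  by move: E; rewrite E1 -/du -/dc => E; lra.
pose e := A i1 i1.
(* Any two leaves have the same sum of diagonal entries; three leaves force all these entries to be
   equal. *)
have eE k : L k -> A k k = e.
  have e12 := E4 _ _ L1 L2 i12; have e13 := E4 _ _ L1 L3 i13.
  have e23 := E4 _ _ L2 L3 i23; rewrite -/e in e12 e13.
  move=> Lk; have [->//|k1] := eqVneq k i1; have := E4 _ _ Lk L1 k1.
  by rewrite -/e => ek1; lra.
have alE : al = 2 * e + dc.
  by have := E4 _ _ L1 L2 i12; rewrite !eE // => <-; ring.
pose Y := \sum_(k | L k) A k c ^+ 2; pose Z := \sum_(k | L k) A k c * A k u.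
have ZE : Z = (d - dc) * A c u.
  have := A3 c t1; rewrite eq_sym tc // => /(_ isT).
  rewrite sumc (QC t1 c) (QC t1 u) !Qt // (AC t1 c).
  have -> : A t1 c = 0 by apply: Atj => //; [exact: tc | rewrite eq_sym].
  have -> : \sum_(k | L k) A c k * Q k t1 = A t1 u * Z.
    rewrite mulr_sumr; apply: eq_bigr => k Lk; rewrite (QC t1 k) Qt // (Atj t1 k) ?uL ?tL //.
    by rewrite (AC k c); ring.
  by rewrite E1 -/d -/du -/dc => E; apply: (mulf_cancel (Atu _ T1)); lra.
(* The leaf rows, weighted by [A k c] and summed, give [Y * A c u = (d - e) * Z]. *)
have YE : Y = (d - e) * (d - dc).
  apply: (mulf_cancel Acu); rewrite mulrBr mulr_sumr.
  rewrite (eq_bigr (fun k => (d - e) * (A k c * A k u))) => [|k Lk].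
    by rewrite -mulr_sumr -/Z ZE; ring.
  by have := E2 _ Lk; rewrite eE // => E; rewrite [RHS]mulrCA -E; ring.
pose S := \sum_(k | k != u) A k u ^+ 2.
have QuE : Q u u = du ^+ 2 + S.
  rewrite mxE (bigD1 u) //= -expr2; congr (_ + _).
  by apply: eq_bigr => k _; rewrite (AC k u) expr2.
have beE : be = S - d ^+ 2 - 2 * d * du.
  have := A3 t1 u (tu _ T1); rewrite sumt // (Qt t1 u T1) QuE E1 -/d -/du => E.
  by apply: (mulf_cancel (Atu _ T1)); lra.
have QcE : Q c c = dc ^+ 2 + A c u ^+ 2 + Y.
  rewrite mxE sumc (AC c u) -!expr2; congr (_ + _).
  by apply: eq_bigr => k _; rewrite (AC k c) expr2.
have QcuE : Q c u = dc * A c u + A c u * du + Z.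
  by rewrite mxE sumc; congr (_ + _); apply: eq_bigr => k _; rewrite (AC k c).
(* Entry [(i1, c)] of the cubic relation. *)
have K : e ^+ 2 + e * dc + dc ^+ 2 + Y = al * (e + dc) + be.
  have E2' : A c u * (A i1 c * A c u) = A c u * ((d - e) * A i1 u) by rewrite E2.
  have := A3 i1 c (cL _ L1); rewrite sumi // (QC c u) QcuE QcE ZE (Qi i1 c L1) -/e -/dc E1 => E.
  by apply: (mulf_cancel (Aic _ L1)); lra.
have S0 : 0 < S.
  rewrite /S (bigD1 t1) ?tu //= ltr_wpDr ?sumr_ge0 // => [l _|]; first exact: sqr_ge0.
  by rewrite exprn_even_gt0 //= Atu.
have Y0 : 0 <= Y by apply: sumr_ge0 => k _; exact: sqr_ge0.
have de0 : 0 <= (d - e) ^+ 2 :> R by exact: sqr_ge0.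
have duE : du = 2 * e + dc - 2 * d by move: E1; rewrite alE => E1; lra.
(* After substitution and by [YE], the relation [K] reads [Y + (d - e) ^+ 2 + S = 0]. *)
suff : S <= 0 by rewrite leNgt S0.
by move: K; rewrite alE beE duE => K; lra.
Qed.

(** * Certificates for the upper bounds *)

Delimit Scope Z_scope with BinZ.

(** * Integer matrices as lists, for evaluation by [vm_compute] *)

Section ListMatrix.
Variables (R : realType) (n : nat).
Implicit Types (A B : seq (seq Z)).

Definition Zr (z : Z) : R := (int_of_Z z)%:~R.

Lemma ZrD x y : Zr (x + y)%BinZ = Zr x + Zr y.
Proof. by rewrite /Zr -intrD -rmorphD. Qed.

Lemma ZrM x y : Zr (x * y)%BinZ = Zr x * Zr y.
Proof. by rewrite /Zr -intrM -rmorphM. Qed.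

Lemma ZrB x y : Zr (x - y)%BinZ = Zr x - Zr y.
Proof. by rewrite /Zr -intrB -rmorphB. Qed.

Lemma Zr_eq0 x : (Zr x == 0) = (x == 0%BinZ).
Proof. by rewrite intr_eq0; case: x => // p; apply/eqP => /=; lia. Qed.

Lemma Zr_gt0 x : (0 < x)%BinZ -> 0 < Zr x.
Proof. by rewrite ltr0z; case: x => //= p _; lia. Qed.

(** Positions outside the lists read as 0, so certificates need no shape conditions. *)
Definition lget A i j : Z := nth 0%BinZ (nth [::] A i) j.

Definition lmat (f : nat -> nat -> Z) : seq (seq Z) :=
  mkseq (fun i => mkseq (f i) n) n.

Definition mx_of A : 'M[R]_n := \matrix_(i, j) Zr (lget A i j).

Lemma mx_of_lmat f : mx_of (lmat f) = \matrix_(i, j) Zr (f i j).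
Proof. by apply/matrixP => i j; rewrite !mxE /lget !nth_mkseq. Qed.

Definition lmul A B :=
  lmat (fun i j => foldr (fun k s => lget A i k * lget B k j + s)%BinZ 0%BinZ (iota 0 n)).

Lemma mx_of_lmul A B : mx_of (lmul A B) = mx_of A *m mx_of B.
Proof.
rewrite mx_of_lmat; apply/matrixP => i j; rewrite !mxE.
rewrite (eq_bigr (fun k : 'I_n => Zr (lget A i k) * Zr (lget B k j))); last first.
  by move=> k _; rewrite !mxE.
rewrite -(big_mkord xpredT (fun k => Zr (lget A i k) * Zr (lget B k j))).
rewrite /index_iota subn0; elim: (iota 0 n) => [|k s IHs]; first by rewrite big_nil.
by rewrite big_cons /= ZrD ZrM IHs.
Qed.

Definition lscalar (e : Z) := lmat (fun i j => if i == j then e else 0%BinZ).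

Definition lsub_scalar A (e : Z) :=
  lmat (fun i j => if i == j then (lget A i j - e)%BinZ else lget A i j).

Definition lchar_prod A (es : seq Z) :=
  foldr (fun e M => lmul (lsub_scalar A e) M) (lscalar 1) es.

Lemma mx_of_lchar_prod A es :
  mx_of (lchar_prod A es) = char_prod (mx_of A) [seq Zr e | e <- es].
Proof.
rewrite /char_prod; elim: es => [|e es IHes] /=.
  rewrite big_nil mx_of_lmat; apply/matrixP => i j; rewrite !mxE val_eqE.
  by case: eqP.
rewrite big_cons mx_of_lmul IHes; congr (_ *m _).
rewrite mx_of_lmat; apply/matrixP => i j; rewrite !mxE val_eqE.
by case: eqP; rewrite ?subr0 // ZrB.
Qed.

End ListMatrix.

(* [C] lists the lower triangle of a symmetric matrix, row by row. *)
Definition tri_get (C : seq (seq Z)) i j := lget C (maxn i j) (minn i j).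

Definition tedge (b : bitseq) i j : bool :=
  ((i < j) && nth false b j)%N || ((j < i) && nth false b i)%N.

Lemma threshold_tedge n (b : n.-tuple bool) i j : threshold_edge b i j = tedge b i j.
Proof. by rewrite /threshold_edge !(tnth_nth false). Qed.

(* The certified matrix is [D C D] with [D = diag (sqrt w)]; it is similar to
   the integer matrix [C D^2]. *)
Definition certificate (b : bitseq) (w : seq Z) (C : seq (seq Z)) (es : seq Z) :=
  let n := size b in
  [&& all (fun i => (0 <? nth 0 w i)%BinZ) (iota 0 n),
      all (fun i => all (fun j => (lget C i j != 0%BinZ) == nth false b i) (iota 0 i))
        (iota 0 n)
    & all (all (fun z : Z => z == 0%BinZ))
        (lchar_prod n (lmat n (fun i j => tri_get C i j * nth 0 w j)%BinZ) es)].

Lemma certificateP (R : realType) n (b : n.-tuple bool) w C es :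
  certificate b w C es ->
  exists2 A : 'M[R]_n, symm_mx (threshold b) A & (q_mx A <= size es)%N.
Proof.
rewrite /certificate size_tuple => /and3P[/allP w0 /allP Cb /allP P0].
have {}w0 (i : 'I_n) : 0 < Zr R (nth 0%BinZ w i).
  by apply: Zr_gt0; apply/Z.ltb_lt; apply: w0; rewrite mem_iota /= add0n.
pose sw (i : 'I_n) := Num.sqrt (Zr R (nth 0%BinZ w i)).
have sw0 i : sw i != 0 by rewrite gt_eqF // sqrtr_gt0.
pose A : 'M[R]_n := \matrix_(i, j) (sw i * Zr R (tri_get C i j) * sw j).
exists A.
  split=> [|i j ij].
    apply/matrixP => i j; rewrite !mxE /tri_get maxnC minnC.
    by rewrite -mulrA mulrC -mulrA mulrCA !mulrA.
  rewrite /= threshold_tedge mxE !mulf_eq0 !negb_or !sw0 /= andbT Zr_eq0 /tri_get /tedge.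
  have Cij (x y : 'I_n) : (x < y)%N -> (lget C y x != 0%BinZ) = nth false b y.
    move=> xy; have /Cb/allP/(_ x) : val y \in iota 0 n by rewrite mem_iota /= add0n.
    by rewrite mem_iota /= add0n => /(_ xy)/eqP.
  by case: ltngtP ij => [lt _|lt _|/val_inj->]; rewrite ?eqxx //= ?Cij ?orbF.
rewrite -(size_map (Zr R)); apply: q_mx_le.
pose D := diag_mx (\row_j sw j).
have Du : D \in unitmx.
  by rewrite unitmxE det_diag unitfE; apply/prodf_neq0 => i _; rewrite mxE.
pose B := lmat n (fun i j => tri_get C i j * nth 0 w j)%BinZ.
(* Here [B] stands for $CD^2$, and $(DCD)D = D(CD^2)$. *)
have AD : A *m D = D *m mx_of R n B.
  rewrite mx_of_lmat mul_mx_diag mul_diag_mx; apply/matrixP => i j; rewrite !mxE.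
  by rewrite ZrM -!mulrA -expr2 sqr_sqrtr // ltW.
have := char_prod_intertwine [seq Zr R e | e <- es] AD.
rewrite -mx_of_lchar_prod.
have -> : mx_of R n (lchar_prod n B es) = 0.
  apply/matrixP => i j; rewrite !mxE; apply/eqP; rewrite Zr_eq0.
  set M := lchar_prod n B es.
  (* The check covers the entries present in [M]; missing ones are 0 by the default of [lget]. *)
  rewrite /lget; have [Mi|Mi] := ltnP i (size M); last first.
    by rewrite [nth [::] _ _]nth_default ?nth_nil.
  have [Mj|Mj] := ltnP j (size (nth [::] M i)); last by rewrite nth_default.
  exact: (allP (P0 _ (mem_nth [::] Mi)) _ (mem_nth 0%BinZ Mj)).
by rewrite mulmx0 => /(congr1 (mulmx^~ (invmx D))); rewrite mulmxK // mul0mx.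
Qed.

(** * From bounds on matrices to bounds on [q_graph] *)

Lemma q_graph_le (R : realType) n (G : sgraph n) (A : 'M[R]_n) k :
  symm_mx G A -> (q_mx A <= k)%N -> (q_graph R G <= k)%N.
Proof.
move=> AG; apply: leq_trans; rewrite /q_graph; case: ex_minnP => m _; apply.
by apply/asboolP; exists A.
Qed.

Lemma q_graph_gt (R : realType) n (G : sgraph n) k :
  (forall A : 'M[R]_n, symm_mx G A -> (k < q_mx A)%N) -> (k < q_graph R G)%N.
Proof.
by move=> kq; rewrite /q_graph; case: ex_minnP => m /asboolP[A /kq kA <-].
Qed.

(* The witnesses for [q_mx_gt2] are the zeros from position [p] on and the ones
   from position [r] on. *)
Definition obstruction (b : bitseq) p r :=
  let n := size b in
  let S := [seq i <- iota 0 n | (p <= i)%N && ~~ nth false b i] in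
  let T := [seq i <- iota 0 n | (r <= i)%N && nth false b i] in
  [&& (size T < size S)%N,
      all (fun i => has (tedge b i) T) S
    & all (fun i => all (fun j => (i == j) ||
        ~~ tedge b i j &&
        all (fun k => tedge b i k && tedge b j k ==> (k \in T)) (iota 0 n)) S) S].

Lemma obstruction_q_gt2 (R : realType) n (b : n.-tuple bool) p r :
  obstruction b p r -> (2 < q_graph R (threshold b))%N.
Proof.
rewrite /obstruction size_tuple => /and3P[].
pose sub P := [seq i <- enum 'I_n | P (val i)].
have subE P : map val (sub P) = [seq i <- iota 0 n | P i].
  by rewrite -val_enum_ord filter_map.
have memE P (i : 'I_n) : (i \in sub P) = (val i \in [seq i <- iota 0 n | P i]).
  by rewrite -subE mem_map //; exact: val_inj.
set T := filter _ _; set S := [seq i <- _ | (p <= i)%N && _] => TS /allP ST /allP SS.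
apply: q_graph_gt => A /(@q_mx_gt2 _ _ _ _ (sub _) (sub _)); apply.
- exact/filter_uniq/enum_uniq.
- exact/filter_uniq/enum_uniq.
- rewrite -(size_map val) subE -[in ltnRHS](size_map val) subE; exact: TS.
- move=> i; rewrite memE => /ST/hasP[k kT ik].
  have kn : (k < n)%N by move: kT; rewrite mem_filter mem_iota => /and3P[].
  by exists (Ordinal kn); rewrite ?memE //= threshold_tedge.
move=> i j; rewrite !memE => iS jS ij.
have /allP/(_ _ jS) := SS _ iS; rewrite val_eqE (negPf ij) /= => /andP[nij /allP kT].
rewrite /= !threshold_tedge; split=> // k; rewrite !threshold_tedge => ik jk.
rewrite memE; apply: (implyP (kT k _)); first by rewrite mem_iota /= add0n.
by rewrite ik jk.
Qed.

(* For [q = 2] the matrices are multiples of projections, onto the span of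
   orthogonal vectors, one per zero of the creation sequence, supported on that
   zero and on the ones after it. Most others extend a matrix [S] of a shorter
   sequence that has a nowhere zero null vector [x]: the new dominating vertex
   gets the row [x], and the new diagonal entries and the scale of [x] are
   chosen to keep the number of eigenvalues down. Runs of equal bits are
   lengthened by splitting a vertex [i] into twins, which adds only an
   eigenvalue [a] already present; twin zeros need [A i i = a]. *)
Definition certificates : seq (bitseq * (seq Z * seq (seq Z) * seq Z)) := [::
  (bits "00101011", ([:: 1; 1; 1; 1; 1; 1; 1; 1],
    [:: [:: 57]; [:: 0; 72]; [:: 57; -48; 89]; [:: 0; 0; 0; 114];
     [:: 38; 48; 6; 38; 70]; [:: 0; 0; 0; 0; 0; 8]; [:: 19; 24; 3; -38; 16; -24; 99];
     [:: 19; 24; 3; -38; 16; 24; -45; 99]],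
    [:: 0; 152]));
  (bits "00100111", ([:: 1; 1; 1; 1; 1; 1; 1; 1],
    [:: [:: 24]; [:: 0; 180]; [:: -84; 180; 474]; [:: 0; 0; 0; 38];
     [:: 0; 0; 0; 0; 480]; [:: 12; 30; -12; -114; 120; 383];
     [:: -48; -120; 48; -76; -120; 154; 358];
     [:: -60; -150; 60; 38; 120; -139; 114; 343]],
    [:: 0; 570]));
  (bits "00011011", ([:: 1; 1; 1; 1; 1; 1; 1; 1],
    [:: [:: 54]; [:: 0; 180]; [:: 0; 0; 54]; [:: -54; -90; 54; 153];
     [:: -90; 30; -54; 21; 209]; [:: 0; 0; 0; 0; 0; 180];
     [:: 18; -60; -54; -42; 14; 90; 125]; [:: 18; -60; -54; -42; 14; -90; 35; 125]],
    [:: 0; 270]));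
  (bits "00010111", ([:: 1; 1; 1; 1; 1; 1; 1; 1],
    [:: [:: 36]; [:: 0; 99]; [:: 0; 0; 11]; [:: 36; -33; -33; 146];
     [:: 0; 0; 0; 0; 44]; [:: -48; -33; -11; -4; -44; 130];
     [:: -12; -66; 11; -23; 44; -17; 103]; [:: -36; 33; -22; 19; 44; 15; 12; 135]],
    [:: 0; 176]));
  (bits "00001111", ([:: 1; 1; 1; 1; 1; 1; 1; 1],
    [:: [:: 10]; [:: 0; 2]; [:: 0; 0; 10]; [:: 0; 0; 0; 10]; [:: -5; 3; 5; 5; 12];
     [:: -5; 3; -5; -5; 2; 12]; [:: 5; 3; -5; 5; 2; 2; 12];
     [:: 5; 3; 5; -5; 2; 2; 2; 12]],
    [:: 0; 20]));
  (bits "01101011", ([:: 1; 1; 1; 1; 1; 1; 1; 1],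
    [:: [:: 1]; [:: -1; 1]; [:: 2; -2; 4]; [:: 0; 0; 0; 3]; [:: 2; -2; 4; 3; 7];
     [:: 0; 0; 0; 0; 0; 8]; [:: 1; -1; 2; -3; -1; -4; 6];
     [:: 1; -1; 2; -3; -1; 4; 2; 6]],
    [:: 0; 12]));
  (bits "01100111", ([:: 1; 1; 1; 1; 1; 1; 1; 1],
    [:: [:: 9]; [:: 6; 4]; [:: -6; -4; 4]; [:: 0; 0; 0; 8]; [:: 0; 0; 0; 0; 8];
     [:: 6; 4; -4; -4; -8; 14]; [:: -6; -4; 4; -8; -4; 4; 14];
     [:: 3; 2; -2; -8; 8; -2; 2; 17]],
    [:: 0; 26]));
  (bits "01011011", ([:: 1; 1; 1; 1; 1; 1; 1; 1],
    [:: [:: 4]; [:: 4; 4]; [:: 0; 0; 12]; [:: -4; -4; -6; 7]; [:: 4; 4; 6; -7; 7];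
     [:: 0; 0; 0; 0; 0; 8]; [:: -4; -4; 6; 1; -1; -8; 15];
     [:: -4; -4; 6; 1; -1; 8; -1; 15]],
    [:: 0; 24]));
  (bits "01010111", ([:: 1; 1; 1; 1; 1; 1; 1; 1],
    [:: [:: 108]; [:: -54; 27]; [:: 0; 0; 7]; [:: -18; 9; -21; 66];
     [:: 0; 0; 0; 0; 21]; [:: 18; -9; 7; -24; 21; 31];
     [:: 18; -9; -21; 60; 21; 3; 87]; [:: 18; -9; -7; 18; -42; -46; -18; 94]],
    [:: 0; 147]));
  (bits "01001111", ([:: 1; 1; 1; 1; 1; 1; 1; 1],
    [:: [:: 2]; [:: -2; 2]; [:: 0; 0; 6]; [:: 0; 0; 0; 6]; [:: 2; -2; 3; -3; 5];
     [:: 2; -2; 3; 3; 2; 5]; [:: -2; 2; 3; 3; -2; 1; 5];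
     [:: -2; 2; 3; -3; 1; -2; 2; 5]],
    [:: 0; 12]));
  (bits "00111011", ([:: 1; 1; 1; 1; 1; 1; 1; 1],
    [:: [:: 4]; [:: 0; 3]; [:: 8; -3; 19]; [:: -4; -6; -2; 16];
     [:: -4; -6; -2; 16; 16]; [:: 0; 0; 0; 0; 0; 12];
     [:: -4; 3; -11; -2; -2; -12; 19]; [:: -4; 3; -11; -2; -2; 12; -5; 19]],
    [:: 0; 36]));
  (bits "00110111", ([:: 1; 1; 1; 1; 1; 1; 1; 1],
    [:: [:: 25]; [:: 0; 5]; [:: 10; -5; 9]; [:: 10; -10; 14; 24]; [:: 0; 0; 0; 0; 27];
     [:: 10; 5; -1; -6; 9; 12]; [:: 10; 5; -1; -6; -18; 3; 21];
     [:: -10; -5; 1; 6; -9; -12; -3; 12]],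
    [:: 0; 45]));
  (bits "00101111", ([:: 1; 1; 1; 1; 1; 1; 1; 1],
    [:: [:: 5]; [:: 0; 2]; [:: -5; -4; 13]; [:: 0; 0; 0; 6]; [:: -5; -2; 9; -6; 13];
     [:: -5; 4; -3; -6; 7; 19]; [:: -5; 4; -3; 6; -5; 7; 19];
     [:: -5; -2; 9; 6; 1; -5; 7; 13]],
    [:: 0; 30]));
  (bits "00011111", ([:: 1; 1; 1; 1; 1; 1; 1; 1],
    [:: [:: 5]; [:: 0; 27]; [:: 0; 0; 3]; [:: 5; 9; -9; 35]; [:: -5; 9; -9; 25; 35];
     [:: -10; 18; 6; -22; -2; 44]; [:: 10; 27; 3; 10; -10; 4; 50];
     [:: 10; -9; 3; -2; -22; -20; 14; 26]],
    [:: 0; 75]));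
  (bits "01111011", ([:: 1; 1; 1; 1; 1; 1; 1; 1],
    [:: [:: 9]; [:: 6; 4]; [:: -3; -2; 1]; [:: 6; 4; -2; 4]; [:: 6; 4; -2; 4; 4];
     [:: 0; 0; 0; 0; 0; 8]; [:: 3; 2; -1; 2; 2; 8; 9];
     [:: 3; 2; -1; 2; 2; -8; -7; 9]],
    [:: 0; 24]));
  (bits "01110111", ([:: 1; 1; 1; 1; 1; 1; 1; 1],
    [:: [:: 1]; [:: -1; 1]; [:: -1; 1; 1]; [:: 2; -2; -2; 4]; [:: 0; 0; 0; 0; 1];
     [:: 1; -1; -1; 2; 2; 5]; [:: -1; 1; 1; -2; -2; -5; 5];
     [:: -2; 2; 2; -4; 2; 2; -2; 8]],
    [:: 0; 13]));
  (bits "01101111", ([:: 1; 1; 1; 1; 1; 1; 1; 1],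
    [:: [:: 4]; [:: 2; 1]; [:: 2; 1; 1]; [:: 0; 0; 0; 2]; [:: -2; -1; -1; 2; 3];
     [:: 2; 1; 1; -2; -3; 3]; [:: 2; 1; 1; 2; 1; -1; 3];
     [:: 2; 1; 1; 2; 1; -1; 3; 3]],
    [:: 0; 10]));
  (bits "01011111", ([:: 1; 1; 1; 1; 1; 1; 1; 1],
    [:: [:: 9]; [:: 3; 1]; [:: 0; 0; 1]; [:: 3; 1; -2; 5]; [:: 3; 1; 2; -3; 5];
     [:: -3; -1; 2; -5; 3; 5]; [:: 3; 1; 1; -1; 3; 1; 2];
     [:: 3; 1; 1; -1; 3; 1; 2; 2]],
    [:: 0; 15]));
  (bits "00111111", ([:: 1; 1; 1; 1; 1; 1; 1; 1],
    [:: [:: 4]; [:: 0; 1]; [:: 2; 2; 5]; [:: 2; -1; -1; 2]; [:: -2; 1; 1; -2; 2];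
     [:: -2; -2; -5; 1; -1; 5]; [:: 4; 1; 4; 1; -1; -4; 5];
     [:: -4; 2; 2; -4; 4; -2; -2; 8]],
    [:: 0; 16]));
  (bits "01111111", ([:: 1; 1; 1; 1; 1; 1; 1; 1],
    [:: [:: 1]; [:: 1; 1]; [:: 1; 1; 1]; [:: 1; 1; 1; 1]; [:: 1; 1; 1; 1; 1];
     [:: 1; 1; 1; 1; 1; 1]; [:: -1; -1; -1; -1; -1; -1; 1];
     [:: 1; 1; 1; 1; 1; 1; -1; 1]],
    [:: 0; 8]));
  (bits "00000001", ([:: 1; 1; 1; 1; 1; 1; 1; 7],
    [:: [:: 0]; [:: 0; 0]; [:: 0; 0; 0]; [:: 0; 0; 0; 0]; [:: 0; 0; 0; 0; 0];
     [:: 0; 0; 0; 0; 0; 0]; [:: 0; 0; 0; 0; 0; 0; 0]; [:: 1; 1; 1; 1; 1; 1; 1; 0]],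
    [:: -7; 0; 7]));
  (bits "00000011", ([:: 1; 1; 1; 1; 1; 1; 2; 2],
    [:: [:: 0]; [:: 0; 0]; [:: 0; 0; 0]; [:: 0; 0; 0; 0]; [:: 0; 0; 0; 0; 0];
     [:: 0; 0; 0; 0; 0; 0]; [:: 2; 2; 2; 2; 2; 2; 1]; [:: 2; 2; 2; 2; 2; 2; 1; 1]],
    [:: -8; 0; 12]));
  (bits "00000101", ([:: 1; 1; 1; 1; 1; 1; 1; 2],
    [:: [:: 1]; [:: 0; 1]; [:: 0; 0; 1]; [:: 0; 0; 0; 1]; [:: 0; 0; 0; 0; 1];
     [:: -1; -1; -1; -1; -1; 5]; [:: 0; 0; 0; 0; 0; 0; 3];
     [:: -1; -1; -1; -1; -1; -1; 3; -1]],
    [:: -6; 1; 6]));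
  (bits "00000111", ([:: 1; 1; 1; 1; 1; 1; 2; 2],
    [:: [:: 0]; [:: 0; 0]; [:: 0; 0; 0]; [:: 0; 0; 0; 0]; [:: 0; 0; 0; 0; 0];
     [:: 2; 2; 2; 2; 2; 3]; [:: 2; 2; 2; 2; 2; 3; 3]; [:: 2; 2; 2; 2; 2; 3; 3; 3]],
    [:: -5; 0; 20]));
  (bits "00001011", ([:: 1; 1; 1; 1; 1; 1; 1; 1],
    [:: [:: 2]; [:: 0; 2]; [:: 0; 0; 2]; [:: 0; 0; 0; 2]; [:: -2; -2; -2; -2; 8];
     [:: 0; 0; 0; 0; 0; 8]; [:: -1; -1; -1; -1; -1; 3; -2];
     [:: -1; -1; -1; -1; -1; 3; 2; -2]],
    [:: -4; 2; 10]));
  (bits "00001101", ([:: 1; 1; 1; 1; 3; 6; 6; 1],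
    [:: [:: 6]; [:: 0; 6]; [:: 0; 0; 6]; [:: 0; 0; 0; 6]; [:: -2; -2; -2; -2; 4];
     [:: -2; -2; -2; -2; 2; 3]; [:: 0; 0; 0; 0; 0; 0; 2];
     [:: 6; 6; 6; 6; 2; 2; 6; 12]],
    [:: -12; 6; 30]));
  (bits "00010011", ([:: 3; 3; 6; 3; 1; 1; 2; 2],
    [:: [:: 0]; [:: 0; 0]; [:: 0; 0; 0]; [:: 2; 2; 2; 0]; [:: 0; 0; 0; 0; -4];
     [:: 0; 0; 0; 0; 0; -4]; [:: 3; 3; 3; 6; 6; 2; 8]; [:: 3; 3; 3; 6; 2; 6; 12; 8]],
    [:: -12; 0; 60]));
  (bits "00010101", ([:: 1; 1; 1; 1; 1; 5; 6; 1],
    [:: [:: 30]; [:: 0; 30]; [:: 0; 0; 30]; [:: -10; -10; -10; 50];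
     [:: 0; 0; 0; 0; 45]; [:: -4; -4; -4; -4; 9; 5]; [:: 0; 0; 0; 0; 0; 0; 8];
     [:: 15; 15; 15; 15; -15; 15; 9; -18]],
    [:: -60; 30; 60]));
  (bits "00011101", ([:: 1; 1; 1; 6; 2; 3; 1; 10],
    [:: [:: 0]; [:: 0; 0]; [:: 0; 0; 0]; [:: -30; -30; -30; 10];
     [:: -90; -90; -90; 30; 90]; [:: -60; -60; -60; 20; 60; 40];
     [:: 0; 0; 0; 0; 0; 0; 0]; [:: -36; -36; 72; -3; -9; 12; 36; 36]],
    [:: -180; 0; 540]));
  (bits "00100001", ([:: 1; 1; 1; 1; 1; 1; 1; 6],
    [:: [:: 21]; [:: 0; -24]; [:: -21; 24; -3]; [:: 0; 0; 0; 0]; [:: 0; 0; 0; 0; 0];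
     [:: 0; 0; 0; 0; 0; 0]; [:: 0; 0; 0; 0; 0; 0; 0]; [:: 6; 6; 6; 6; 6; 6; 6; -1]],
    [:: -42; 0; 36]));
  (bits "00100011", ([:: 1; 1; 1; 1; 1; 1; 2; 1],
    [:: [:: 6]; [:: 0; -10]; [:: -6; 10; -4]; [:: 0; 0; 0; 0]; [:: 0; 0; 0; 0; 0];
     [:: 0; 0; 0; 0; 0; 0]; [:: 3; 3; 3; 1; 1; 1; 2]; [:: 6; 6; 6; 2; 2; 2; -6; -2]],
    [:: -18; 0; 10]));
  (bits "00100101", ([:: 1; 1; 1; 10; 30; 10; 30; 105],
    [:: [:: 3150]; [:: 0; -1890]; [:: -1890; 3150; 0]; [:: 0; 0; 0; -63];
     [:: 0; 0; 0; 0; -21]; [:: -630; -630; -630; 126; 126; -63];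
     [:: 0; 0; 0; 0; 0; 0; -49]; [:: -90; -90; -90; -36; -36; -18; 56; 8]],
    [:: -4410; -630; 4410]));
  (bits "00101001", ([:: 1; 1; 1; 7; 2; 1; 1; 2],
    [:: [:: 90]; [:: 0; -150]; [:: -150; 90; 0]; [:: 0; 0; 0; 20];
     [:: -45; -45; -45; 35; -40]; [:: 0; 0; 0; 0; 0; 0]; [:: 0; 0; 0; 0; 0; 0; 0];
     [:: -63; -63; -63; -21; 42; 42; 42; 0]],
    [:: -210; 0; 210]));
  (bits "00101101", ([:: 1; 1; 1; 1; 1; 1; 1; 10],
    [:: [:: -24]; [:: 0; -15]; [:: -24; 15; -39]; [:: 0; 0; 0; -40];
     [:: 12; 15; -3; 20; -31]; [:: -12; -15; 3; 20; 11; -31];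
     [:: 0; 0; 0; 0; 0; 0; 0]; [:: 6; -6; -6; 9; 9; 9; 3; 0]],
    [:: -60; 0; 60]));
  (bits "00110001", ([:: 1; 1; 1; 1; 1; 1; 1; 15],
    [:: [:: 10]; [:: 0; 20]; [:: 10; 10; 15]; [:: 10; -10; 5; 15]; [:: 0; 0; 0; 0; 0];
     [:: 0; 0; 0; 0; 0; 0]; [:: 0; 0; 0; 0; 0; 0; 0];
     [:: -4; -6; 8; -4; 4; 4; 4; -4]],
    [:: -90; 0; 30]));
  (bits "00110011", ([:: 1; 1; 2; 2; 1; 1; 2; 2],
    [:: [:: 20]; [:: 0; -12]; [:: -10; 6; 11]; [:: -10; 6; -7; 11];
     [:: 0; 0; 0; 0; 0]; [:: 0; 0; 0; 0; 0; 0]; [:: -6; -6; -3; -3; 6; 6; -1];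
     [:: -6; -6; -3; -3; 6; 6; 9; -1]],
    [:: -20; 0; 36]));
  (bits "00110101", ([:: 1; 1; 2; 2; 2; 1; 190; 5],
    [:: [:: 80]; [:: 0; -70]; [:: -40; 35; -30]; [:: -40; 35; 35; -30];
     [:: 0; 0; 0; 0; 65]; [:: 8; -28; 10; 10; 26; 0]; [:: 0; 0; 0; 0; 0; 0; 0];
     [:: 8; 2; 5; 5; -4; 20; 4; 2]],
    [:: -130; 0; 140]));
  (bits "00111001", ([:: 1; 1; 3; 3; 3; 1; 1; 1],
    [:: [:: 90]; [:: 0; -54]; [:: -30; 18; 31]; [:: -30; 18; -23; 31];
     [:: -30; 18; 4; 4; 4]; [:: 0; 0; 0; 0; 0; 0]; [:: 0; 0; 0; 0; 0; 0; 0];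
     [:: 54; 54; 18; 18; 18; 54; 54; 72]],
    [:: -90; 0; 162]));
  (bits "00111101", ([:: 1; 1; 1; 1; 1; 1; 1; 15],
    [:: [:: -60]; [:: 0; -24]; [:: -30; 24; -99]; [:: -30; -24; 9; -99];
     [:: -30; 24; 21; 9; -99]; [:: 30; 24; -9; -21; -9; -99];
     [:: 0; 0; 0; 0; 0; 0; 0]; [:: -10; 60; 20; -10; 20; 10; 10; 32]],
    [:: -120; 0; 600]));
  (bits "01000001", ([:: 1; 1; 1; 1; 1; 1; 1; 1],
    [:: [:: -1]; [:: 2; -4]; [:: 0; 0; 0]; [:: 0; 0; 0; 0]; [:: 0; 0; 0; 0; 0];
     [:: 0; 0; 0; 0; 0; 0]; [:: 0; 0; 0; 0; 0; 0; 0]; [:: 4; 2; 1; 1; 1; 1; 1; 0]],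
    [:: -5; 0; 5]));
  (bits "01000011", ([:: 1; 1; 1; 1; 1; 1; 2; 2],
    [:: [:: 2]; [:: -2; 2]; [:: 0; 0; 0]; [:: 0; 0; 0; 0]; [:: 0; 0; 0; 0; 0];
     [:: 0; 0; 0; 0; 0; 0]; [:: 1; 1; 1; 1; 1; 1; -2]; [:: 1; 1; 1; 1; 1; 1; 1; -2]],
    [:: -6; 0; 4]));
  (bits "01000101", ([:: 1; 1; 1; 1; 1; 3; 10; 2],
    [:: [:: 45]; [:: 15; 45]; [:: 0; 0; 30]; [:: 0; 0; 0; 30]; [:: 0; 0; 0; 0; 30];
     [:: -12; 12; 2; 2; 2; 10]; [:: 0; 0; 0; 0; 0; 0; 4];
     [:: 18; -18; -3; -3; -3; 15; 5; -5]],
    [:: -60; 30; 60]));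
  (bits "01000111", ([:: 1; 1; 1; 1; 1; 1; 2; 2],
    [:: [:: 5]; [:: 5; 5]; [:: 0; 0; 0]; [:: 0; 0; 0; 0]; [:: 0; 0; 0; 0; 0];
     [:: -4; 4; 4; 4; 4; 2]; [:: -1; 1; 1; 1; 1; -2; 2];
     [:: -1; 1; 1; 1; 1; -2; 2; 2]],
    [:: -10; 0; 10]));
  (bits "01001011", ([:: 1; 1; 1; 1; 6; 2; 1; 1],
    [:: [:: 72]; [:: 36; 168]; [:: 0; 0; 60]; [:: 0; 0; 0; 60];
     [:: 30; -10; 10; 10; 20]; [:: 0; 0; 0; 0; 0; 45];
     [:: -30; 10; -10; -10; 10; 30; 150]; [:: -30; 10; -10; -10; 10; 30; -30; 150]],
    [:: -30; 60; 180]));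
  (bits "01001101", ([:: 1; 1; 2; 2; 1; 3; 1; 1],
    [:: [:: -6]; [:: 6; -6]; [:: 0; 0; 0]; [:: 0; 0; 0; 0]; [:: -6; -6; 3; 3; 6];
     [:: -6; -6; 3; 3; 6; 6]; [:: 0; 0; 0; 0; 0; 0; 0];
     [:: 4; 4; 4; 4; -12; 4; 12; 24]],
    [:: -12; 0; 36]));
  (bits "01010001", ([:: 1; 1; 7; 3; 1; 1; 1; 42],
    [:: [:: 0]; [:: 42; 0]; [:: 0; 0; -3]; [:: -28; -28; 7; 21]; [:: 0; 0; 0; 0; 0];
     [:: 0; 0; 0; 0; 0; 0]; [:: 0; 0; 0; 0; 0; 0; 0];
     [:: -2; -2; -1; -1; 6; 6; 6; 2]],
    [:: -42; 0; 126]));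
  (bits "01010011", ([:: 1; 1; 15; 1; 1; 1; 21; 7],
    [:: [:: -105]; [:: 105; -105]; [:: 0; 0; 7]; [:: 420; -420; 105; -105];
     [:: 0; 0; 0; 0; 0]; [:: 0; 0; 0; 0; 0; 0]; [:: 45; -15; -15; 15; 15; 15; 20];
     [:: 135; -45; -45; 45; 45; 45; -30; 0]],
    [:: -840; 0; 630]));
  (bits "01010101", ([:: 1; 1; 1; 1; 10; 1; 2; 1],
    [:: [:: 12]; [:: 24; 48]; [:: 0; 0; 0]; [:: -40; 20; 20; 20]; [:: 0; 0; 0; 0; 1];
     [:: -40; 20; 20; -40; 10; 0]; [:: 0; 0; 0; 0; 0; 0; 0];
     [:: 10; -5; -5; 10; 10; -10; 45; -30]],
    [:: -90; 0; 60]));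
  (bits "01011001", ([:: 1; 1; 1; 1; 1; 1; 1; 6],
    [:: [:: -9]; [:: 3; -9]; [:: 0; 0; -8]; [:: -3; -3; -4; -5];
     [:: -3; -3; 4; -1; -5]; [:: 0; 0; 0; 0; 0; 0]; [:: 0; 0; 0; 0; 0; 0; 0];
     [:: -2; -2; 4; -2; 6; 4; 4; 6]],
    [:: -12; 0; 48]));
  (bits "01011101", ([:: 1; 1; 1; 1; 1; 1; 1; 6],
    [:: [:: 72]; [:: 72; 72]; [:: 0; 0; 396]; [:: -144; -144; -132; 332];
     [:: 72; 72; 264; -232; 248]; [:: 144; 144; -264; -200; -32; 464];
     [:: 0; 0; 0; 0; 0; 0; 0]; [:: 363; -66; -66; 66; 33; -99; 33; -66]],
    [:: -1188; 0; 792]));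
  (bits "01100001", ([:: 1; 1; 1; 1; 1; 1; 1; 2],
    [:: [:: 2]; [:: 2; 2]; [:: 2; 2; 2]; [:: 0; 0; 0; 0]; [:: 0; 0; 0; 0; 0];
     [:: 0; 0; 0; 0; 0; 0]; [:: 0; 0; 0; 0; 0; 0; 0]; [:: -1; -2; 3; 1; 1; 1; 1; 0]],
    [:: -6; 0; 6]));
  (bits "01100011", ([:: 1; 1; 1; 1; 1; 1; 2; 2],
    [:: [:: 2]; [:: 2; 2]; [:: -2; -2; 2]; [:: 0; 0; 0; 0]; [:: 0; 0; 0; 0; 0];
     [:: 0; 0; 0; 0; 0; 0]; [:: 2; -4; -2; 1; 1; 1; -3];
     [:: 2; -4; -2; 1; 1; 1; -3; -3]],
    [:: -18; 0; 6]));
  (bits "01100101", ([:: 1; 6; 3; 2; 2; 6; 1; 2],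
    [:: [:: -27]; [:: 3; -5]; [:: 3; 1; -11]; [:: 0; 0; 0; -9]; [:: 0; 0; 0; 0; -9];
     [:: -3; -1; -1; 3; 3; -3]; [:: 0; 0; 0; 0; 0; 0; -24];
     [:: -9; -3; -3; 9; 9; 9; 12; 21]],
    [:: -36; -18; 72]));
  (bits "01101001", ([:: 1; 2; 2; 14; 2; 1; 1; 42],
    [:: [:: 84]; [:: 42; 147]; [:: 42; -105; 147]; [:: 0; 0; 0; -6];
     [:: 168; 84; 84; 42; 42]; [:: 0; 0; 0; 0; 0; 0]; [:: 0; 0; 0; 0; 0; 0; 0];
     [:: 36; 6; 6; -12; -12; 12; 12; 4]],
    [:: -336; 0; 504]));
  (bits "01101101", ([:: 1; 2; 2; 1; 1; 1; 1; 6],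
    [:: [:: 12]; [:: 6; 15]; [:: 6; -9; 15]; [:: 0; 0; 0; 16]; [:: 12; 6; 6; 16; 28];
     [:: 12; 6; 6; -16; -4; 28]; [:: 0; 0; 0; 0; 0; 0; 0];
     [:: -20; 4; 4; -4; 8; 4; 4; -4]],
    [:: -72; 0; 48]));
  (bits "01110001", ([:: 1; 1; 3; 1; 1; 1; 1; 3],
    [:: [:: -10]; [:: -2; -1]; [:: -2; -1; -1]; [:: 2; -2; -2; -10];
     [:: 0; 0; 0; 0; 0]; [:: 0; 0; 0; 0; 0; 0]; [:: 0; 0; 0; 0; 0; 0; 0];
     [:: 4; -4; -4; 4; 4; 4; 4; 8]],
    [:: -12; 0; 36]));
  (bits "01110011", ([:: 1; 1; 1; 2; 1; 1; 1; 1],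
    [:: [:: -4]; [:: 2; -1]; [:: 2; 7; -1]; [:: 2; -5; -5; 3]; [:: 0; 0; 0; 0; 0];
     [:: 0; 0; 0; 0; 0; 0]; [:: -4; -2; -2; -2; 4; 4; 12];
     [:: -4; -2; -2; -2; 4; 4; -4; 12]],
    [:: -8; 0; 16]));
  (bits "01110101", ([:: 1; 1; 2; 6; 1; 1; 30; 2],
    [:: [:: -150]; [:: 30; -190]; [:: 30; 50; -70]; [:: 30; -10; -10; -20];
     [:: 0; 0; 0; 0; -60]; [:: 60; 20; 20; 20; 60; -180]; [:: 0; 0; 0; 0; 0; 0; -3];
     [:: -60; -20; -20; -20; -60; -60; 15; -15]],
    [:: -240; -60; 180]));
  (bits "01111001", ([:: 1; 1; 1; 1; 1; 1; 1; 6],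
    [:: [:: 6]; [:: -6; 6]; [:: -6; 6; 6]; [:: 6; -6; -6; 6]; [:: -6; 6; 6; -6; 6];
     [:: 0; 0; 0; 0; 0; 0]; [:: 0; 0; 0; 0; 0; 0; 0];
     [:: -15; -10; 10; 10; -5; 5; 5; -15]],
    [:: -120; 0; 30]));
  (bits "01111101", ([:: 1; 1; 1; 1; 1; 1; 1; 2],
    [:: [:: 2]; [:: -4; 8]; [:: 2; -4; 2]; [:: -2; 4; -2; 2]; [:: 4; -8; 4; -4; 8];
     [:: 6; -12; 6; -6; 12; 18]; [:: 0; 0; 0; 0; 0; 0; 0];
     [:: 10; 5; 5; -5; 10; -10; 5; 10]],
    [:: -20; 0; 40]));
  (bits "00010001", ([:: 1; 1; 1; 1; 1; 1; 1; 1],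
    [:: [:: -15]; [:: 0; -15]; [:: 0; 0; -15]; [:: -5; -5; -5; -5];
     [:: 0; 0; 0; 0; 0]; [:: 0; 0; 0; 0; 0; 0]; [:: 0; 0; 0; 0; 0; 0; 0];
     [:: 2; 2; 2; -6; 3; 3; 3; -10]],
    [:: -20; -15; 0; 5]));
  (bits "00001001", ([:: 1; 1; 1; 1; 1; 1; 1; 7],
    [:: [:: 7]; [:: 0; 7]; [:: 0; 0; 7]; [:: 0; 0; 0; 7]; [:: -7; -7; -7; -7; 28];
     [:: 0; 0; 0; 0; 0; 0]; [:: 0; 0; 0; 0; 0; 0; 0]; [:: 1; 1; 1; 1; 1; 1; 1; 0]],
    [:: -7; 0; 7; 35]));
  (bits "01001001", ([:: 1; 1; 1; 1; 1; 1; 1; 30],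
    [:: [:: -45]; [:: -45; -45]; [:: 0; 0; -90]; [:: 0; 0; 0; -90];
     [:: 45; 45; 45; 45; -90]; [:: 0; 0; 0; 0; 0; 0]; [:: 0; 0; 0; 0; 0; 0; 0];
     [:: -12; 8; -2; -2; -4; 8; 8; -4]],
    [:: -180; -90; 0; 60]));
  (bits "00011001", ([:: 1; 1; 1; 2; 1; 1; 1; 3],
    [:: [:: 3]; [:: 0; 3]; [:: 0; 0; 3]; [:: 1; 1; 1; 1]; [:: 1; 1; 1; 1; 1];
     [:: 0; 0; 0; 0; 0; 0]; [:: 0; 0; 0; 0; 0; 0; 0];
     [:: -1; -1; -1; 1; 1; 3; 3; -2]],
    [:: -12; 0; 3; 6]))]%BinZ.

(* [if] rather than [&&], which [vm_compute] evaluates strictly. *)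
Definition certified (k : nat) (b : bitseq) := has (fun c =>
  if c.1 == b then (size c.2.2 <= k)%N && certificate b c.2.1.1 c.2.1.2 c.2.2
  else false)
  certificates.

(** The positions [p] and [r] are found by search, so no table of witnesses is kept. *)
Definition obstructed (b : bitseq) :=
  has (fun p => has (obstruction b p) (iota 0 (size b))) (iota 0 (size b)).

(** * Enumeration of bit sequences *)

Fixpoint bitseqs n : seq bitseq :=
  if n is n'.+1 then map (cons false) (bitseqs n') ++ map (cons true) (bitseqs n')
  else [:: [::]].

Lemma mem_bitseqs (b : bitseq) : b \in bitseqs (size b).
Proof.
by elim: b => [|[] b IHb] //=; rewrite mem_cat map_f ?orbT.
Qed.

Lemma size_bitseqs n b : b \in bitseqs n -> size b = n.
Proof.
elim: n b => [|n IHn] b /=; first by rewrite inE => /eqP->.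
by rewrite mem_cat => /orP[] /mapP[c /IHn <- ->].
Qed.

Lemma bitseqs_uniq n : uniq (bitseqs n).
Proof.
elim: n => //= n IHn; rewrite cat_uniq !map_inj_uniq ?IHn // => [|s t []|s t []] //.
by rewrite andbT; apply/hasPn => _ /mapP[s _ ->]; apply/negP => /mapP[].
Qed.

(** Replaces the enumeration of tuples by an explicit list, on which the count can be computed. *)
Lemma card_tuple_bitseqs n (S : {set n.-tuple bool}) (P : pred bitseq) :
  (forall b, (b \in S) = P (tval b)) -> #|S| = count P (bitseqs n).
Proof.
move=> SP; rewrite cardE -(size_map val) -size_filter; apply/perm_size/uniq_perm.
- by rewrite map_inj_uniq ?enum_uniq //; exact: val_inj.
- exact/filter_uniq/bitseqs_uniq.
move=> s; rewrite mem_filter; apply/mapP/andP => [[b]|[Ps sn]].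
  rewrite mem_enum SP => Pb ->; split=> //; rewrite -[in bitseqs _](size_tuple b).
  exact: mem_bitseqs.
have sz : size s == n by apply/eqP/size_bitseqs.
by exists (Tuple sz); rewrite // mem_enum SP.
Qed.

(** * Application to the graphs of order 8 *)

Lemma certified_q_le (R : realType) n (b : n.-tuple bool) k :
  certified k b -> (q_graph R (threshold b) <= k)%N.
Proof.
rewrite /certified => /hasP[c _].
case: ifP => // _ /andP[ck /(certificateP R)[A AG Ac]].
exact: q_graph_le AG (leq_trans Ac ck).
Qed.

Lemma obstructed_q_gt2 (R : realType) n (b : n.-tuple bool) :
  obstructed b -> (2 < q_graph R (threshold b))%N.
Proof. by rewrite /obstructed => /hasP[p _ /hasP[r _]]; apply: obstruction_q_gt2. Qed.

Lemma seqs_i_q_gt3 (R : realType) (b : 8.-tuple bool) :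
  b \in seqs_i -> (3 < q_graph R (threshold b))%N.
Proof.
rewrite inE !inE => /pred2P[] bE; apply: q_graph_gt => A AG.
(* For [00010001]: centre 3, leaves 0, 1, 2, pendant vertices 4 and 5, dominating vertex 7. *)
- apply: (@q_mx_gt3 _ _ _ (@Ordinal 8 7 isT) (@Ordinal 8 3 isT) (@Ordinal 8 4 isT)
    (@Ordinal 8 5 isT) (@Ordinal 8 0 isT) (@Ordinal 8 1 isT) (@Ordinal 8 2 isT)
    (fun k : 'I_8 => k < 3)%N A _ AG).
  split => //= [[k kP]|[i iP] [k kP] /= i3|t [k kP]]; rewrite threshold_tedge bE.
  + by move: k kP => [|[|[|[|[|[|[|[|k]]]]]]]].
  + by move: i iP i3 k kP => [|[|[|i]]] // iP _ [|[|[|[|[|[|[|[|k]]]]]]]].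
  by rewrite !inE => /pred2P[] ->; move: k kP => [|[|[|[|[|[|[|[|k]]]]]]]].
(* For [00001001]: centre 4, four leaves 0 to 3, three of them named, pendant vertices 5 and 6. *)
apply: (@q_mx_gt3 _ _ _ (@Ordinal 8 7 isT) (@Ordinal 8 4 isT) (@Ordinal 8 5 isT)
  (@Ordinal 8 6 isT) (@Ordinal 8 0 isT) (@Ordinal 8 1 isT) (@Ordinal 8 2 isT)
  (fun k : 'I_8 => k < 4)%N A _ AG).
split => //= [[k kP]|[i iP] [k kP] /= i4|t [k kP]]; rewrite threshold_tedge bE.
- by move: k kP => [|[|[|[|[|[|[|[|k]]]]]]]].
- by move: i iP i4 k kP => [|[|[|[|i]]]] // iP _ [|[|[|[|[|[|[|[|k]]]]]]]].
by rewrite !inE => /pred2P[] ->; move: k kP => [|[|[|[|[|[|[|[|k]]]]]]]].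
Qed.

Local Close Scope ring_scope.

Lemma connected_q_gt1 (R : realType) (b : 8.-tuple bool) :
  nth false b 7 -> 1 < q_graph R (threshold b).
Proof.
move=> b7; apply: q_graph_gt => A AG.
apply: (@q_mx_gt1 _ _ _ _ (@Ordinal 8 0 isT) (@Ordinal 8 7 isT) AG).
by rewrite /= threshold_tedge /tedge b7.
Qed.

Theorem mainTheorem13 (R : realType) :
  [/\ forall b : 8.-tuple bool, b \in seqs_i -> q_graph R (threshold b) = 4,
      forall b : 8.-tuple bool, b \in seqs_ii -> q_graph R (threshold b) \in [:: 3; 4],
      forall b : 8.-tuple bool, b \in seqs_iii -> q_graph R (threshold b) = 2,
      #|seqs_iv| = 40
    & forall b : 8.-tuple bool, b \in seqs_iv -> q_graph R (threshold b) = 3].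
Proof.
split.
- move=> b bi; apply/eqP; rewrite eqn_leq seqs_i_q_gt3 // andbT certified_q_le //.
  move: bi; rewrite inE; apply/(allP (a := certified 4)).
  by vm_compute.
- move=> b; rewrite inE => bii.
  have : (q_graph R (threshold b) <= 4) && (2 < q_graph R (threshold b)).
    rewrite certified_q_le ?obstructed_q_gt2 //; move: bii.
      by apply/(allP (a := obstructed)); vm_compute.
    by apply/(allP (a := certified 4)); vm_compute.
  by case: (q_graph _ _) => [|[|[|[|[]]]]].
- move=> b; rewrite inE => biii.
  apply/eqP; rewrite eqn_leq certified_q_le ?connected_q_gt1 //; move: biii.
    by apply/(allP (a := fun b => nth false b 7)); vm_compute.
  by apply/(allP (a := certified 2)); vm_compute.
(* The predicate on bit sequences is left to unification, which reads it off the unfolded membership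
   in [seqs_iv]; the count then runs over all 256 bit sequences. *)
- eapply etrans.
    apply: card_tuple_bitseqs => b; rewrite !inE !(tnth_nth false).
    by move: (tval b) => s; reflexivity.
  by vm_compute.
move=> b; rewrite !inE !(tnth_nth false) => biv.
suff /andP[b3 b2] : certified 3 b && obstructed b.
  by apply/eqP; rewrite eqn_leq certified_q_le ?obstructed_q_gt2.
(* Membership in [seqs_iv] becomes a boolean premise, and the implication is checked on all 256 bit
   sequences. *)
move: biv; have := mem_bitseqs b; rewrite size_tuple; move: (tval b) => s s8.
by apply/implyP; move: s s8; apply/allP; vm_compute.
Qed.
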